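(* Let $p$ be an odd prime, $m,s$ positive integers, $R=\mathbb F_{p^m}+u\mathbb F_{p^m}$ with $u^2=0$, and let $\sigma$ be a ring automorphism of $R$ with $\sigma^{-1}=\Theta_{\theta,\varepsilon}$, where $\theta\in \mathrm{Aut}(\mathbb F_{p^m})$, $\varepsilon\in\mathbb F_{p^m}^\ast$. Let $\gamma\in\mathbb F_{p^m}^\ast$, let $\gamma_0\in\mathbb F_{p^m}$ be the element with $\gamma_0^{p^s}=\gamma^{-1}$, and assume $\gamma_0=\theta(\gamma_0^{-1})$. Let $C=\langle(\gamma_0x-1)^i\rangle\subseteq R[x]/\langle x^{p^s}-\gamma\rangle$ be a $\gamma$-constacyclic code of length $p^s$ over $R$, where $1\le i\le p^s-1$. Then $C$ is $\sigma$-self-orthogonal if and only if $i\ge\frac{p^s}2$.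
   Context: $\Theta_{\theta,\varepsilon}:R\to R$ is the ring automorphism $a+ub\mapsto\theta(a)+u\varepsilon\theta(b)$ ($a,b\in\mathbb F_{p^m}$); every ring automorphism of $R$ has this form. A $\gamma$-constacyclic code of length $n$ over $R$ is an $R$-submodule of $R^n$ stable under $(x_0,\dots,x_{n-1})\mapsto(\gamma x_{n-1},x_0,\dots,x_{n-2})$; it is identified with an ideal of $R[x]/\langle x^n-\gamma\rangle$ via $(c_0,\dots,c_{n-1})\mapsto c_0+c_1x+\cdots+c_{n-1}x^{n-1}$. The $\sigma$-dual of $C\subseteq R^n$ is $C^{\perp_\sigma}=\{\mathbf x\in R^n:\sum_{i=0}^{n-1}c_i\sigma(x_i)=0\text{ for all }\mathbf c\in C\}$; $C$ is $\sigma$-self-orthogonal if $C\subseteq C^{\perp_\sigma}$. *)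

(* Defs.v *)
From HB Require Import structures.
From mathcomp Require Import all_boot all_order all_algebra.
From mathcomp Require Export qpoly.

Set Implicit Arguments.
Unset Strict Implicit.
Unset Printing Implicit Defensive.

Import Order.TTheory GRing.Theory Num.Theory.
Local Open Scope ring_scope.

(* F + uF with u^2 = 0 is F[u]/<u^2>.  An element is a polynomial a + b u of
   size at most 2, so a and b are its coefficients of index 0 and 1. *)
Notation chain_ring F := {poly %/ ('X^2 : {poly F})}.

Section ChainRing.

Variable F : finFieldType.

Definition scal : F -> chain_ring F := qpolyC 'X^2.

Definition uelt : chain_ring F := 'qX.

Definition Theta (theta : F -> F) (eps : F) (x : chain_ring F) : chain_ring F :=
  scal (theta (polyn x)`_0) + uelt * scal eps * scal (theta (polyn x)`_1).

End ChainRing.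

(* For n > 0 the modulus is monic of positive degree, so {poly %/ _} is the
   genuine quotient by it. *)
Notation ambient n gamma := {poly %/ ('X^n - gamma%:P)}.

Section Codes.

Variables (R : comNzRingType) (n : nat).

Implicit Type C : 'rV[R]_n -> Prop.

Definition submodule C : Prop :=
  [/\ C 0, forall x y, C x -> C y -> C (x + y) & forall a x, C x -> C (a *: x)].

(* [ord_pred] is the cyclic predecessor, so index 0 receives x_(n-1). *)
Definition constashift (gamma : R) (x : 'rV[R]_n) : 'rV[R]_n :=
  \row_i (if i == 0 :> nat then gamma * x 0 (ord_pred i) else x 0 (ord_pred i)).

Definition constacyclic (gamma : R) C : Prop :=
  submodule C /\ forall x, C x -> C (constashift gamma x).

Definition word_poly (gamma : R) (c : 'rV[R]_n) : ambient n gamma :=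
  in_qpoly ('X^n - gamma%:P) (\sum_(i < n) c 0 i *: 'X^i).

Definition sigma_dual (sigma : R -> R) C : 'rV[R]_n -> Prop :=
  fun x => forall c, C c -> \sum_(i < n) c 0 i * sigma (x 0 i) = 0.

Definition sigma_self_orthogonal (sigma : R -> R) C : Prop :=
  forall x, C x -> sigma_dual sigma C x.

End Codes.

Definition principal_ideal (A : comNzRingType) (g : A) : A -> Prop :=
  fun a => exists q, a = q * g.

(* C corresponds to the ideal <g> under the bijection [word_poly gamma]. *)
Definition code_of (R : comNzRingType) (n : nat) (gamma : R)
    (C : 'rV[R]_n -> Prop) (g : ambient n gamma) : Prop :=
  forall c, C c <-> principal_ideal g (word_poly gamma c).

(* Main.v *)
(** Put N = p^s, a = gamma_0^-1 and b = gamma_0.  In characteristic p the modulus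
    x^N - gamma is (x - a)^N, so C is the set of words whose polynomial is a
    multiple of (x - a)^i.  The condition on theta says that sigma exchanges a
    and b, so sigma turns a word of C into a multiple of (x - b)^i, whose
    reversal is again a multiple of (x - a)^i because ab = 1.  The inner product
    of c and sigma(x) is the coefficient of x^(N-1) in the product of c and the
    reversal of sigma(x), a multiple of (x - a)^(2i) of degree at most 2N - 2;
    when 2i >= N it is a multiple of x^N - gamma, and that coefficient vanishes.
    When 2i < N, the words (x - a)^(N-1-i) and x^(N-1-i) (x - a)^i both lie in C,
    and the supports of the first and of the image of the second under sigma
    meet only at N-1-i, where the product of the entries is the unit (-b)^i. *)
Require Import Defs.
From mathcomp Require Import all_boot all_order all_algebra finfield.
From mathcomp Require Import zify.
Import GRing.Theory Num.Theory.
Local Open Scope ring_scope.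

(* x^(n-1) q(1/x), for q of size at most n. *)
Definition revp {R : comNzRingType} (n : nat) (q : {poly R}) : {poly R} :=
  \poly_(j < n) q`_(n - j.+1).

Lemma coef_mul_revp {R : comNzRingType} (n : nat) (p q : {poly R}) :
  (0 < n)%N -> (p * revp n q)`_n.-1 = \sum_(j < n) p`_j * q`_j.
Proof.
case: n => // n _; rewrite coefM; apply: eq_bigr => j _.
by rewrite coef_poly ltnS leq_subr subSS subKn // -ltnS.
Qed.

(** Reversal is multiplicative when lengths add, and [1 - a%:P * 'X] reverses ['X - a%:P]. The size
    bound keeps [revp n] from truncating [q]. *)
Lemma revp_mul_XsubC {R : comNzRingType} (n : nat) (q : {poly R}) (a : R) :
  (size q <= n)%N ->
  revp n.+1 (q * ('X - a%:P)) = revp n q * (1 - a%:P * 'X).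
Proof.
move=> sq; apply/polyP => j.
rewrite !mulrBr mulr1 [revp n q * _]mulrCA [RHS]coefB coefCM coefMX !coef_poly.
rewrite ltnS subSS coefB coefMX coefMC mulrC.
case: j => [|j] /=.
  rewrite subn0 mulr0 subr0 (nth_default 0 sq) mulr0 subr0.
  by case: n sq => [|n] sq //=; rewrite subn1.
case: (ltngtP j.+1 n) => h.
- by rewrite subn_eq0 leqNgt h !subnS.
- by rewrite mulr0 subr0.
- by rewrite h subnn.
Qed.

(** A monic factor shifts the degree exactly, even when [R] has zero divisors. *)
Lemma size_mul_exp_XsubC {R : comNzRingType} (q : {poly R}) (a : R) (i n : nat) :
  (size (q * ('X - a%:P) ^+ i)%R <= n + i)%N = (size q <= n)%N.
Proof.
have [->|q0] := eqVneq q 0; first by rewrite mul0r size_poly0.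
by rewrite size_Mmonic ?monic_exp ?monicXsubC // size_exp_XsubC addnS leq_add2r.
Qed.

Lemma revp_mul_exp_XsubC {R : comNzRingType} (n i : nat) (q : {poly R}) (a : R) :
  (size q <= n)%N ->
  revp (n + i) (q * ('X - a%:P) ^+ i) = revp n q * (1 - a%:P * 'X) ^+ i.
Proof.
move=> sq; elim: i => [|i IHi]; first by rewrite addn0 !mulr1.
rewrite addnS !exprSr !mulrA revp_mul_XsubC ?IHi //.
by rewrite size_mul_exp_XsubC.
Qed.

Lemma sum_coef_mul_eq0 {R : comNzRingType} (n i : nat) (a b g : R)
    (p q p1 q1 : {poly R}) :
  (0 < n)%N -> (i <= n <= i.*2)%N -> b * a = 1 ->
  'X^n - g%:P = ('X - a%:P) ^+ n ->
  (size p <= n)%N -> (size q <= n)%N ->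
  p = p1 * ('X - a%:P) ^+ i -> q = q1 * ('X - b%:P) ^+ i ->
  \sum_(j < n) p`_j * q`_j = 0.
Proof.
move=> n0 /andP[le_in le_n2i] ba1 Xng sp sq Dp Dq.
have sq1 : (size q1 <= n - i)%N.
  by rewrite -(size_mul_exp_XsubC _ b i) -Dq subnK.
have rev_b : 1 - b%:P * 'X = (- b)%:P * ('X - a%:P) :> {poly R}.
  by rewrite polyCN mulNr mulrBr opprB -polyCM ba1.
have Drev :
    revp n q = (revp (n - i) q1 * (- b)%:P ^+ i) * ('X - a%:P) ^+ i.
  by rewrite -{1}(subnK le_in) Dq revp_mul_exp_XsubC // rev_b exprMn mulrA.
pose w := p1 * (revp (n - i) q1 * (- b)%:P ^+ i) * ('X - a%:P) ^+ (i.*2 - n).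
have Dw : p * revp n q = w * ('X^n - g%:P).
  rewrite Xng /w -[RHS]mulrA -exprD subnK // Drev Dp -addnn exprD.
  rewrite -!mulrA; congr (_ * _).
  by rewrite mulrCA; congr (_ * _); exact: mulrCA.
(* The product has size at most 2n - 1; cancelling a monic factor of degree n leaves [w] without a
   coefficient of index n - 1. *)
have sw : (size w <= n.-1)%N.
  rewrite -(size_mul_exp_XsubC _ a n) -Xng -Dw.
  apply: leq_trans (size_polyMleq _ _) _.
  have := size_poly n (fun j => q`_(n - j.+1)); rewrite -/(revp n q); lia.
rewrite -coef_mul_revp // Dw mulrBr coefB coefMXn coefMC prednK // leqnn.
by rewrite (nth_default 0 sw) mul0r subrr.
Qed.

Lemma sum_coef_exp_XsubC {R : comNzRingType} (n i : nat) (a b : R) :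
  (i < n)%N ->
  \sum_(j < n) (('X - a%:P) ^+ (n - i.+1))`_j
               * ('X^(n - i.+1) * ('X - b%:P) ^+ i)`_j = (- b) ^+ i.
Proof.
move=> lt_in; have lt_k : (n - i.+1 < n)%N by lia.
set k := (n - i.+1)%N in lt_k *.
have monic_coef : (('X - a%:P) ^+ k)`_k = 1.
  have /monicP := monic_exp k (monicXsubC a).
  by rewrite /lead_coef size_exp_XsubC.
rewrite (bigD1 (Ordinal lt_k)) //= big1 ?addr0 => [|j].
  rewrite monic_coef mul1r coefXnM ltnn subnn -horner_coef0 horner_exp.
  by rewrite hornerXsubC sub0r.
rewrite -val_eqE /= => ne_jk; rewrite coefXnM; case: ltnP => [_|le_kj].
  by rewrite mulr0.
rewrite nth_default ?mul0r // size_exp_XsubC; lia.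
Qed.

Lemma word_polyE {R : comNzRingType} (n : nat) (g : R) (c : 'rV[R]_n) :
  word_poly g c = in_qpoly ('X^n - g%:P) (rVpoly c).
Proof.
congr in_qpoly; rewrite /rVpoly poly_def.
by apply: eq_bigr => j _; rewrite valK.
Qed.

Lemma in_qpoly_eq0 {R : comNzRingType} (h p : {poly R}) :
  (1 < size h)%N -> h \is monic ->
  in_qpoly h p = 0 -> exists w, p = w * h.
Proof.
move=> sh hm /(congr1 val) /= e.
apply/(Pdiv.RingMonic.rdvdpP hm); apply/eqP.
(* [mk_monic h] is [h] only for monic [h] of size above 1; otherwise it defaults to ['X]. *)
by move: e; rewrite /mk_monic sh hm.
Qed.

(** As [b] is a unit, the generator is an associate of the class of (x - a)^i. Lifting to
    polynomials adds a multiple of the modulus (x - a)^n, which (x - a)^i divides since i <= n. *)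
Lemma principal_idealP {R : comNzRingType} (n i : nat) (a b g : R)
    (c : 'rV[R]_n) :
  (0 < n)%N -> (i <= n)%N -> b * a = 1 ->
  'X^n - g%:P = ('X - a%:P) ^+ n ->
  principal_ideal ((b *: 'qX - 1 : ambient n g) ^+ i) (word_poly g c) <->
  exists q, rVpoly c = q * ('X - a%:P) ^+ i.
Proof.
move=> n0 le_in ba1 Xng; rewrite word_polyE; set h := 'X^n - g%:P.
have Dg : (b *: 'qX - 1 : {poly %/ h}) = in_qpoly h (b *: ('X - a%:P)).
  rewrite scalerBr raddfB /= in_qpolyZ -[in RHS]mul_polyC -polyCM ba1.
  by rewrite rmorph1.
rewrite Dg -rmorphXn exprZn /=; split=> [[q Dq]|[q Dq]].
  have Dqq : q = in_qpoly h (val q).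
    by apply/val_inj/esym/in_qpoly_small; apply: size_mk_monic.
  have [w Dw] : exists w,
      rVpoly c - val q * (b ^+ i *: ('X - a%:P) ^+ i) = w * h.
    apply: in_qpoly_eq0; rewrite ?size_XnsubC ?monicXnsubC //.
    by rewrite raddfB /= rmorphM /= -Dqq -Dq subrr.
  exists (w * ('X - a%:P) ^+ (n - i) + b ^+ i *: val q).
  rewrite mulrDl -mulrA -exprD subnK // -Xng -/h -Dw -scalerAr -scalerAl.
  by rewrite subrK.
exists (in_qpoly h (a ^+ i *: q)).
rewrite -rmorphM /= -scalerAr -scalerAl scalerA -exprMn ba1 expr1n scale1r.
by rewrite Dq.
Qed.

(** Frobenius is additive, and an odd exponent preserves the sign of [- a]. *)
Lemma XnsubC_pchar {R : comNzRingType} (p s : nat) (a : R) :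
  p \in [pchar R] -> odd p ->
  'X^(p ^ s) - (a ^+ (p ^ s))%:P = ('X - a%:P) ^+ (p ^ s).
Proof.
move=> pR p_odd; have pP : p \in [pchar {poly R}] by apply: (rmorph_pchar polyC).
rewrite exprDn_pchar; last first.
  by rewrite pnatX (eq_pnat _ (pcharf_eq pP)) pnat_id ?(pcharf_prime pP).
by rewrite exprNn -signr_odd oddX p_odd orbT mulN1r rmorphXn.
Qed.

Lemma Theta_scal (F : finFieldType) (theta : {rmorphism F -> F}) (eps a : F) :
  Theta theta eps (scal a) = scal (theta a).
Proof.
rewrite /Theta /= !coefC /= !rmorph0.
by rewrite [@scal F 0](rmorph0 (qpolyC 'X^2)) mulr0 addr0.
Qed.

Theorem theorem4p5 (p m s : nat) (hp : prime p) (hodd : odd p)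
  (hm : (0 < m)%N) (hs : (0 < s)%N)
  (F : finFieldType) (hF : #|F| = (p ^ m)%N)
  (theta : {rmorphism F -> F}) (htheta : bijective theta)
  (eps : F) (heps : eps != 0)
  (sigma : {rmorphism chain_ring F -> chain_ring F})
  (hsigmaK : cancel sigma (Theta theta eps))
  (hThetaK : cancel (Theta theta eps) sigma)
  (gamma : F) (hgamma : gamma != 0)
  (gamma0 : F) (hgamma0 : gamma0 ^+ (p ^ s) = gamma^-1)
  (hfix : gamma0 = theta gamma0^-1)
  (i : nat) (hi1 : (1 <= i)%N) (hi2 : (i <= p ^ s - 1)%N)
  (C : 'rV[chain_ring F]_(p ^ s) -> Prop)
  (hC : constacyclic (scal gamma) C)
  (hgen : code_of C
            ((scal gamma0 *: 'qX - 1 : ambient (p ^ s) (scal gamma)) ^+ i)) :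
  sigma_self_orthogonal sigma C <-> (p ^ s)%:R / 2%:R <= i%:R :> rat.
Proof.
have N_gt0 : (0 < p ^ s)%N by rewrite expn_gt0 prime_gt0.
have g0_neq0 : gamma0 != 0.
  apply: contraNneq hgamma => g0; move: hgamma0.
  by rewrite g0 expr0n -(prednK N_gt0) /= => /esym/eqP; rewrite invr_eq0.
set a := scal gamma0^-1; set b := scal gamma0 in hgen.
have ba1 : b * a = 1.
  by rewrite -[LHS](rmorphM (qpolyC 'X^2)) mulfV ?(rmorph1 (qpolyC 'X^2)).
have sigma_a : sigma a = b.
  (* Inverting [hfix] gives theta(gamma0) = gamma0^-1. *)
  suff -> : a = Theta theta eps b by rewrite hThetaK.
  by rewrite Theta_scal /a hfix fmorphV invrK -fmorphV -hfix.
have Xng : 'X^(p ^ s) - (scal gamma)%:P = ('X - a%:P) ^+ (p ^ s).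
  have -> : scal gamma = a ^+ (p ^ s).
    by rewrite -[RHS](rmorphXn (qpolyC 'X^2)) exprVn hgamma0 invrK.
  apply: XnsubC_pchar => //; rewrite pchar_qpoly.
  exact: card_finPcharP hF hp.
have le_iN : (i <= p ^ s)%N by rewrite (leq_trans hi2) ?leq_subr.
have memC c : C c <-> exists q, rVpoly c = q * ('X - a%:P) ^+ i.
  by rewrite hgen; apply: principal_idealP.
have dotE (c x : 'rV[chain_ring F]_(p ^ s)) :
    \sum_j c 0 j * sigma (x 0 j)
      = \sum_(j < p ^ s) (rVpoly c)`_j * (map_poly sigma (rVpoly x))`_j.
  by apply: eq_bigr => j _; rewrite coef_map !coef_rVpoly_ord.
rewrite ler_pdivrMr ?ltr0n // -natrM ler_nat muln2; split=> [self_orth|le_N2i].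
  rewrite leqNgt; apply/negP => lt_2iN; set k := (p ^ s - i.+1)%N.
  pose c := poly_rV (('X - a%:P) ^+ k) : 'rV[chain_ring F]_(p ^ s).
  pose x := poly_rV ('X^k * ('X - a%:P) ^+ i) : 'rV[chain_ring F]_(p ^ s).
  have Dc : rVpoly c = ('X - a%:P) ^+ k.
    by rewrite poly_rV_K // size_exp_XsubC /k; lia.
  have Dx : rVpoly x = 'X^k * ('X - a%:P) ^+ i.
    rewrite poly_rV_K //.
    have -> : (p ^ s = k.+1 + i)%N by rewrite /k; lia.
    by rewrite size_mul_exp_XsubC size_polyXn.
  have Cc : C c.
    (* Here 2i < p^s gives i <= k. *)
    apply/memC; exists (('X - a%:P) ^+ (k - i)).
    by rewrite Dc -exprD subnK // /k; lia.
  have Cx : C x by apply/memC; exists 'X^k.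
  have := self_orth x Cx c Cc; rewrite dotE Dc Dx rmorphM !rmorphXn /=.
  rewrite map_polyX map_polyXsubC sigma_a sum_coef_exp_XsubC; last by lia.
  (* Multiplying (-b)^i = 0 by (-a)^i gives 1 = 0. *)
  move/(congr1 ( *%R^~ ((- a) ^+ i))); rewrite -exprMn mulrNN ba1 expr1n mul0r.
  by move/eqP; rewrite oner_eq0.
move=> x /memC[q Dx] c /memC[r Dc]; rewrite dotE.
apply: (@sum_coef_mul_eq0 _ _ i a b (scal gamma) _ _ r (map_poly sigma q)) => //.
- by rewrite le_iN.
- exact: size_poly.
- exact: leq_trans (size_poly _ _) (size_poly _ _).
by rewrite Dx rmorphM rmorphXn /= map_polyXsubC sigma_a.
Qed.
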